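(* Let $X$ be a topological space, $M\in\mathbb{R}$, $s>0$, and let $f,g:X\to(-\infty,M]$ be functions, not necessarily continuous. Let $F,G:(\mathbb{R},\leq)\to\mathbf{Pair}$ be the extended persistence diagrams of pairs associated to $f$ and $g$ (with the same $M$ and $s$). Let $\mathbf{D}$ be any category and $H:\mathbf{Pair}\to\mathbf{D}$ any functor. Then $$d(HF,HG)\leq\|f-g\|_\infty.$$
   Context: $(\mathbb{R},\leq)$ denotes the poset of real numbers viewed as a category. $\mathbf{Pair}$ is the category whose objects are pairs $(X,A)$ with $X$ a topological space and $A\subseteq X$ a subspace, and whose morphisms $(X,A)\to(Y,B)$ are continuous maps $f:X\to Y$ with $f(A)\subseteq B$. The extended persistence diagram $F:(\mathbb{R},\leq)\to\mathbf{Pair}$ of $f:X\to(-\infty,M]$ (with spacing $s>0$) is: $F(c)=(f^{-1}(-\infty,c],\emptyset)$ for $c<M+s$, and $F(c)=(X,f^{-1}[2M+s-c,\infty))$ for $c\geq M+s$; for $c\leq d$, $F(c\leq d)$ is the inclusion. All subsets carry the subspace topology. $G$ is defined in the same way from $g$. $\|f-g\|_\infty=\sup_{x\in X}|f(x)-g(x)|\in[0,\infty]$. For $b\geq 0$, $T_b:(\mathbb{R},\leq)\to(\mathbb{R},\leq)$ is the functor $T_b(a)=a+b$. For $\varepsilon\geq 0$, functors $P,Q:(\mathbb{R},\leq)\to\mathbf{D}$ are $\varepsilon$-interleaved if there are natural transformations $\varphi:P\Rightarrow QT_\varepsilon$ and $\psi:Q\Rightarrow PT_\varepsilon$ such that for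 all $a\in\mathbb{R}$, $\psi(a+\varepsilon)\varphi(a)=P(a\leq a+2\varepsilon)$ and $\varphi(a+\varepsilon)\psi(a)=Q(a\leq a+2\varepsilon)$. The interleaving distance is $d(P,Q)=\inf\{\varepsilon\geq 0\mid P\text{ and }Q\text{ are }\varepsilon\text{-interleaved}\}$, equal to $\infty$ if there is no such $\varepsilon$. *)

(* Defs.v *)
From HB Require Import structures.
From mathcomp Require Import all_boot all_order all_algebra.
From mathcomp Require Import all_classical reals constructive_ereal ereal topology.
From mathcomp Require Import interval_inference.

Set Implicit Arguments.
Unset Strict Implicit.
Unset Printing Implicit Defensive.

Import Order.TTheory GRing.Theory Num.Theory.

Local Open Scope classical_set_scope.
Local Open Scope ring_scope.

Record category := Category {
  obj :> Type;
  hom : obj -> obj -> Type;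
  idm : forall a, hom a a;
  comp : forall a b c, hom b c -> hom a b -> hom a c;
  comp1m : forall a b (u : hom a b), comp (idm b) u = u;
  compm1 : forall a b (u : hom a b), comp u (idm a) = u;
  compmA : forall a b c d (w : hom c d) (v : hom b c) (u : hom a b),
    comp w (comp v u) = comp (comp w v) u }.

Record functor (C D : category) := Functor {
  fobj :> C -> D;
  fmap : forall a b : C, hom a b -> hom (fobj a) (fobj b);
  fmap1 : forall a : C, fmap (idm a) = idm (fobj a);
  fmapM : forall (a b c : C) (v : hom b c) (u : hom a b),
    fmap (comp v u) = comp (fmap v) (fmap u) }.

Arguments fmap {C D} f {a b} _.

Section FunctorComposition.
Variables (C D E : category) (Q : functor D E) (P : functor C D).

Fact fcomp1 (a : C) : fmap Q (fmap P (idm a)) = idm (Q (P a)).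
Proof. by rewrite !fmap1. Qed.

Fact fcompM (a b c : C) (v : hom b c) (u : hom a b) :
  fmap Q (fmap P (comp v u)) = comp (fmap Q (fmap P v)) (fmap Q (fmap P u)).
Proof. by rewrite !fmapM. Qed.

Definition fcomp : functor C E :=
  @Functor C E (fun a => Q (P a)) (fun a b u => fmap Q (fmap P u))
    fcomp1 fcompM.

End FunctorComposition.

Record nattrans (C D : category) (P Q : functor C D) := NatTrans {
  component :> forall a : C, hom (P a) (Q a);
  naturality : forall (a b : C) (u : hom a b),
    comp (component b) (fmap P u) = comp (fmap Q u) (component a) }.

Definition poset_cat (d : Order.disp_t) (T : porderType d) : category :=
  @Category T (fun a b => (a <= b)%O)
    (fun a => lexx a) (fun a b c bc ab => le_trans ab bc)
    (fun _ _ _ => bool_irrelevance _ _)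
    (fun _ _ _ => bool_irrelevance _ _)
    (fun _ _ _ _ _ _ _ => bool_irrelevance _ _).

Section Interleaving.
Variable R : realType.

Fact shift_le (b x y : R) : x <= y -> x + b <= y + b.
Proof. by rewrite lerD2r. Qed.

Definition shift (b : R) : functor (poset_cat R) (poset_cat R) :=
  @Functor (poset_cat R) (poset_cat R) (fun a => a + b) (@shift_le b)
    (fun _ => bool_irrelevance _ _) (fun _ _ _ _ _ => bool_irrelevance _ _).

Fact le_shift2 (e : {nonneg R}) (a : R) : a <= a + e%:num + e%:num.
Proof. by rewrite -addrA lerDl. Qed.

Variable D : category.
Implicit Types P Q : functor (poset_cat R) D.

(* [a + e + e] stands for a + 2e: it is the index that the composites
   [psi (a + e) \o phi a] reach by conversion. *)
Definition interleaved (e : {nonneg R}) P Q : Prop :=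
  exists (phi : nattrans P (fcomp Q (shift e%:num)))
         (psi : nattrans Q (fcomp P (shift e%:num))),
    forall a : R,
      comp (psi (a + e%:num)) (phi a)
        = fmap P (le_shift2 e a : @hom (poset_cat R) _ _) /\
      comp (phi (a + e%:num)) (psi a)
        = fmap Q (le_shift2 e a : @hom (poset_cat R) _ _).

Definition interleaving_dist P Q : \bar R :=
  ereal_inf [set e%:num%:E | e in [set e : {nonneg R} | interleaved e P Q]].

End Interleaving.

(* The point 0 only matters when [T] is empty: the supremum is taken in
   [0, +oo], whereas [ereal_sup set0] is -oo. *)
Definition sup_dist (R : realType) (T : Type) (f g : T -> R) : \bar R :=
  ereal_sup (0%E |` range (fun x => `|f x - g x|%:E)).

Record top_pair := TopPair {
  pspace :> topologicalType;
  psubset : set pspace }.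

Arguments psubset : clear implicits.

Record pair_map (P Q : top_pair) := PairMap {
  pmap :> P -> Q;
  pmap_continuous : continuous pmap;
  pmap_sub : pmap @` psubset P `<=` psubset Q }.

Lemma pair_map_ext (P Q : top_pair) (u v : pair_map P Q) : u =1 v -> u = v.
Proof.
case: u v => [u cu su] [v cv sv] /= /funext uv.
by case: _ / uv cv sv => cv sv; congr PairMap; apply: Prop_irrelevance.
Qed.

Section PairCategory.

Fact pair_id_continuous (P : top_pair) : continuous (id : P -> P).
Proof. by move=> x. Qed.

Fact pair_id_sub (P : top_pair) : (id : P -> P) @` psubset P `<=` psubset P.
Proof. by rewrite image_id. Qed.

Definition pair_id (P : top_pair) : pair_map P P :=
  PairMap (@pair_id_continuous P) (@pair_id_sub P).

Variables (P Q Z : top_pair) (v : pair_map Q Z) (u : pair_map P Q).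

Fact pair_comp_continuous : continuous (v \o u).
Proof. by move=> x; apply: continuous_comp; apply: pmap_continuous. Qed.

Fact pair_comp_sub : (v \o u) @` psubset P `<=` psubset Z.
Proof.
move=> _ [x Px <-]; apply: (@pmap_sub _ _ v); exists (u x) => //.
by apply: (@pmap_sub _ _ u); exists x.
Qed.

Definition pair_comp : pair_map P Z := PairMap pair_comp_continuous pair_comp_sub.

End PairCategory.

Definition pair_cat : category.
Proof.
by apply: (@Category top_pair pair_map pair_id pair_comp) => *;
  apply: pair_map_ext.
Defined.

Section ExtendedPersistence.
Variables (R : realType) (X : topologicalType) (M s : R) (f : X -> R).

Definition sublevel (c : R) : set X := f @^-1` `]-oo, c].
Definition superlevel (t : R) : set X := f @^-1` `[t, +oo[.

(* A set coerces to its type of elements, which carries the subspace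
   topology. *)
Definition sublevel_pair (c : R) : top_pair := @TopPair (sublevel c) set0.
Definition superlevel_pair (t : R) : top_pair := @TopPair X (superlevel t).

Fact sublevel_le (c d : R) : c <= d -> sublevel c `<=` sublevel d.
Proof. by move=> cd x; rewrite /sublevel /= !in_itv /= => /le_trans; apply. Qed.

Fact superlevel_le (t r : R) : r <= t -> superlevel t `<=` superlevel r.
Proof.
by move=> rt x; rewrite /superlevel /= !in_itv /= !andbT; apply: le_trans.
Qed.

Section Inclusions.
Variables (c d : R) (cd : c <= d).

Definition sub_incl_fun : sublevel_pair c -> sublevel_pair d :=
  subfun (sublevel_le cd).

Fact sub_incl_continuous : continuous sub_incl_fun.
Proof. exact/continuous_comp_initial/initial_continuous. Qed.

Fact sub_incl_sub : sub_incl_fun @` set0 `<=` set0.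
Proof. by rewrite image_set0. Qed.

Definition sub_incl : pair_map (sublevel_pair c) (sublevel_pair d) :=
  PairMap sub_incl_continuous sub_incl_sub.

Fact mix_incl_continuous : continuous (set_val : sublevel c -> X).
Proof. exact: initial_continuous. Qed.

Fact mix_incl_sub t :
  (set_val : sublevel_pair c -> X) @` set0 `<=` superlevel t.
Proof. by rewrite image_set0. Qed.

Definition mix_incl t : pair_map (sublevel_pair c) (superlevel_pair t) :=
  @PairMap (sublevel_pair c) (superlevel_pair t)
    set_val mix_incl_continuous (@mix_incl_sub t).

End Inclusions.

Fact super_incl_sub (t r : R) (rt : r <= t) :
  (id : X -> X) @` superlevel t `<=` superlevel r.
Proof. by rewrite image_id; apply: superlevel_le. Qed.

Definition super_incl (t r : R) (rt : r <= t) :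
    pair_map (superlevel_pair t) (superlevel_pair r) :=
  @PairMap (superlevel_pair t) (superlevel_pair r)
    id (@pair_id_continuous (superlevel_pair t)) (super_incl_sub rt).

(* The boolean [b] is the truth value of [c < M + s]. *)
Definition epd_obj_ (b : bool) (c : R) : top_pair :=
  if b then sublevel_pair c else superlevel_pair (2 * M + s - c).

Fact reflect_le (c d : R) : c <= d -> 2 * M + s - d <= 2 * M + s - c.
Proof. by move=> cd; rewrite lerD2l lerN2. Qed.

Definition epd_map_ (b b' : bool) (c d : R) (cd : c <= d) :
    (b' -> b) -> pair_map (epd_obj_ b c) (epd_obj_ b' d) :=
  match b, b' with
  | true, true => fun _ => sub_incl cd
  | true, false => fun _ => mix_incl c (2 * M + s - d)
  | false, true => fun b'b => False_rect _ (notF (b'b isT))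
  | false, false => fun _ => super_incl (reflect_le cd)
  end.

Definition epd_obj (c : R) : top_pair := epd_obj_ (c < M + s) c.

Definition epd_map (c d : R) (cd : c <= d) :
    pair_map (epd_obj c) (epd_obj d) :=
  epd_map_ cd (fun dMs : d < M + s => le_lt_trans cd dMs).

Fact epd_map1 (c : R) : epd_map (lexx c) = pair_id (epd_obj c).
Proof.
apply: pair_map_ext; rewrite /epd_map /epd_obj.
move: (fun _ => _); case: (c < M + s) => // h x.
by apply: val_inj.
Qed.

Fact epd_mapM (c d e : R) (de : d <= e) (cd : c <= d) :
  epd_map (le_trans cd de) = pair_comp (epd_map de) (epd_map cd).
Proof.
apply: pair_map_ext; rewrite /epd_map /epd_obj.
move: (fun _ => _) (fun _ => _) (fun _ => _).
case: (c < M + s); case: (d < M + s); case: (e < M + s) => //=.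
- by move=> _ _ _ x; apply: val_inj.
- by move=> _ h; have := h isT.
- by move=> h; have := h isT.
- by move=> h; have := h isT.
- by move=> _ h; have := h isT.
Qed.

Definition epd : functor (poset_cat R) pair_cat :=
  @Functor (poset_cat R) pair_cat epd_obj epd_map epd_map1
    (fun c d e de cd => epd_mapM de cd).

End ExtendedPersistence.

(* Main.v *)
From mathcomp Require Import all_boot all_order all_algebra.
From mathcomp Require Import all_classical reals constructive_ereal ereal topology.
From mathcomp Require Import interval_inference.
Require Import Defs.

(** Every pair of an extended persistence diagram sits over X: its space is
    X itself or a subspace of X, and every map of the diagram is compatible
    with the inclusions into X. As these inclusions are injective, there is at
    most one map over X between two such pairs, even when they come from the
    diagrams of two different functions ([over_base_unique]).

    If |f - g| <= e pointwise, then a sublevel set of f at height c lies in the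
    sublevel set of g at height c + e, and a superlevel set of f at height t
    lies in the superlevel set of g at height t - e. Since superlevel heights
    run backwards along the diagram, both inclusions go from index c to index
    c + e, so a map over X from F(c) to G(c + e) exists ([epd_lift]); likewise
    with f and g exchanged. Naturality and the two triangle identities are
    equalities between maps over X, hence hold by uniqueness: F and G are
    e-interleaved ([epd_interleaved]).

    A functor H carries an interleaving to an interleaving
    ([interleaved_fcomp]), so HF and HG are e-interleaved as well. When the sup
    distance is finite, it is itself an admissible e; when it is infinite, there
    is nothing to prove. *)

Set Implicit Arguments.
Unset Strict Implicit.
Unset Printing Implicit Defensive.

Import Order.TTheory GRing.Theory Num.Theory.

Local Open Scope classical_set_scope.
Local Open Scope ring_scope.

Section InterleavingImage.
Variables (R : realType) (C D : category) (H : functor C D).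

Definition whisker (e : R) (P Q : functor (poset_cat R) C)
    (phi : nattrans P (fcomp Q (shift e))) :
  nattrans (fcomp H P) (fcomp (fcomp H Q) (shift e)).
Proof.
refine (@NatTrans _ _ (fcomp H P) (fcomp (fcomp H Q) (shift e))
  (fun a => fmap H (phi a)) _) => a b u.
have := congr1 (fmap H) (naturality phi u).
by rewrite !fmapM.
Defined.

Lemma interleaved_fcomp (e : {nonneg R}) (P Q : functor (poset_cat R) C) :
  interleaved e P Q -> interleaved e (fcomp H P) (fcomp H Q).
Proof.
move=> [phi [psi tri]]; exists (whisker phi), (whisker psi) => a.
have [tP tQ] := tri a; split => /=.
- by rewrite -tP fmapM.
- by rewrite -tQ fmapM.
Qed.

End InterleavingImage.

Section MapsOverBase.
Variables (R : realType) (X : topologicalType) (M s : R).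
Implicit Types f g h : X -> R.

(** The regime is a separate boolean so that one can destruct c < M + s in the
    type of a diagram space and in its inclusion at the same time. *)
Definition base_pt_ f (b : bool) (c : R) : epd_obj_ M s f b c -> X :=
  match b with true => set_val | false => id end.

Definition base_pt f (c : R) : epd M s f c -> X := @base_pt_ f (c < M + s) c.

Lemma base_pt_inj f c : injective (@base_pt f c).
Proof. by rewrite /base_pt /= /epd_obj; case: (c < M + s). Qed.

Definition over_base f g c d (u : pair_map (epd M s f c) (epd M s g d)) :=
  forall x, base_pt (u x) = base_pt x.

(** This replaces all computations with the four regime combinations in the
    naturality squares and in the triangle identities. *)
Lemma over_base_unique f g c d (u v : pair_map (epd M s f c) (epd M s g d)) :
  over_base u -> over_base v -> u = v.
Proof.
by move=> ou ov; apply: pair_map_ext => x; apply: base_pt_inj; rewrite ou ov.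
Qed.

Lemma over_base_comp f g h c d e (v : pair_map (epd M s g d) (epd M s h e))
    (u : pair_map (epd M s f c) (epd M s g d)) :
  over_base v -> over_base u -> over_base (pair_comp v u).
Proof. by move=> ov ou x; rewrite /= ov ou. Qed.

Lemma over_base_fmap f (c d : R) (cd : c <= d) :
  over_base (fmap (epd M s f) (cd : @hom (poset_cat R) c d)).
Proof.
rewrite /over_base /base_pt /= /epd_map /epd_obj.
move: (fun _ => _); case: (c < M + s); case: (d < M + s) => //= h.
by have := h isT.
Qed.

(** Since c <= d, an index in the superlevel regime is not sent back to the
    sublevel regime. The crossing from sublevel to superlevel regime costs
    nothing, because the pair at c then has the empty set as its subspace. *)
Lemma epd_lift f g (c d : R) : c <= d ->
  sublevel f c `<=` sublevel g d ->
  superlevel f (2 * M + s - c) `<=` superlevel g (2 * M + s - d) ->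
  {u : pair_map (epd M s f c) (epd M s g d) | over_base u}.
Proof.
move=> cd sub sup; rewrite /over_base /base_pt /= /epd_obj.
have: d < M + s -> c < M + s by exact: le_lt_trans.
case: (c < M + s); case: (d < M + s) => /= back.
- have cont : continuous (subfun sub : sublevel_pair f c -> sublevel_pair g d).
    exact/continuous_comp_initial/initial_continuous.
  unshelve eexists (@PairMap (sublevel_pair f c) (sublevel_pair g d)
    (subfun sub) cont _); last by [].
  by rewrite image_set0.
- unshelve eexists (@PairMap (sublevel_pair f c)
    (superlevel_pair g (2 * M + s - d)) set_val
    (@mix_incl_continuous _ _ f c) _); last by [].
  by rewrite image_set0.
- by have := back isT.
- unshelve eexists (@PairMap (superlevel_pair f (2 * M + s - c))
    (superlevel_pair g (2 * M + s - d)) id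
    (@pair_id_continuous (superlevel_pair f _)) _); last by [].
  by rewrite image_id.
Qed.

End MapsOverBase.

Section Stability.
Variables (R : realType) (X : topologicalType) (M s : R) (e : {nonneg R}).
Implicit Types f g : X -> R.

(** In the sublevel regime f <= c gives g <= c + e. In the superlevel regime the
    height 2M + s - c drops by e as c grows by e, which is exactly the room that
    g >= f - e requires. *)
Lemma epd_shift_lift f g (c : R) : (forall x, `|f x - g x| <= e%:num) ->
  {u : pair_map (epd M s f c) (epd M s g (c + e%:num)) | over_base u}.
Proof.
move=> fg; apply: epd_lift => [|x|x]; rewrite ?lerDl //.
- rewrite /sublevel /= !in_itv /= => fc.
  by rewrite -(subrK (f x) (g x)) addrC lerD // (le_trans (ler_norm _)) // distrC.
- rewrite /superlevel /= !in_itv /= !andbT => fc.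
  by rewrite opprD addrA lerBlDr (le_trans fc) // -lerBlDl (le_trans (ler_norm _)).
Qed.

Definition epd_shift f g (fg : forall x, `|f x - g x| <= e%:num) :
  nattrans (epd M s f) (fcomp (epd M s g) (shift e%:num)).
Proof.
refine (@NatTrans _ _ (epd M s f) (fcomp (epd M s g) (shift e%:num))
  (fun c => sval (epd_shift_lift c fg)) _) => a b ab.
apply: over_base_unique.
- apply: over_base_comp; first exact: svalP.
  exact: over_base_fmap.
- apply: over_base_comp; last exact: svalP.
  exact: (over_base_fmap (shift_le e%:num ab)).
Defined.

Lemma over_base_epd_shift f g (fg : forall x, `|f x - g x| <= e%:num) c :
  over_base (epd_shift fg c).
Proof. exact: svalP. Qed.

Lemma epd_interleaved f g : (forall x, `|f x - g x| <= e%:num) ->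
  interleaved e (epd M s f) (epd M s g).
Proof.
move=> fg; have gf x : `|g x - f x| <= e%:num by rewrite distrC.
exists (epd_shift fg), (epd_shift gf) => a.
by split; (apply: over_base_unique; last exact: over_base_fmap);
  apply: over_base_comp; apply: over_base_epd_shift.
Qed.

End Stability.

Theorem theorem6p1 (R : realType) (X : topologicalType) (M s : R)
    (f g : X -> R) (D : category) (H : functor pair_cat D) :
  0 < s ->
  (forall x : X, f x <= M) ->
  (forall x : X, g x <= M) ->
  (interleaving_dist (fcomp H (epd M s f)) (fcomp H (epd M s g))
     <= sup_dist f g)%E.
Proof.
move=> _ _ _.
have sup_ge0 : (0 <= sup_dist f g)%E by apply: ereal_sup_ubound; left.
have sup_ge x : (`|f x - g x|%:E <= sup_dist f g)%E.
  by apply: ereal_sup_ubound; right; exists x.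
case: (sup_dist f g) sup_ge0 sup_ge => [r| |] //; last by move=> _ _; exact: leey.
rewrite lee_fin => r0 fg.
(* The finite sup distance r is itself an interleaving parameter. *)
apply: ereal_inf_lbound; exists (NngNum r0) => //.
apply: interleaved_fcomp; apply: epd_interleaved => x.
by rewrite -lee_fin; apply: fg.
Qed.
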